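(* Let $R$ be a commutative ring with identity satisfying $J(R)=0$. Then $\mathrm{Max}(R)$ is an EZ-space if and only if for every ideal $I$ of $R$ there exists a subset $E$ of idempotents of $R$ such that $\mathrm{Ann}(I)=\mathrm{Ann}(E)$.
   Context: $J(R)$ is the Jacobson radical of $R$. For a subset $S$ of $R$, $\mathrm{Ann}(S)=\{r\in R: rs=0\text{ for all }s\in S\}$. $\mathrm{Max}(R)$ is the space of maximal ideals of $R$ with the Zariski topology, with basic open sets $D(a)=\{M\in\mathrm{Max}(R): a\notin M\}$, $a\in R$. A topological space $Y$ is an EZ-space if for every open subset $A$ of $Y$ there is a collection $\{A_\alpha:\alpha\in S\}$ of clopen subsets of $Y$ with $\mathrm{cl}_Y A=\mathrm{cl}_Y(\bigcup_{\alpha\in S}A_\alpha)$. *)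

(* Defs.v *)
From HB Require Import structures.
From mathcomp Require Import all_boot all_order all_algebra.
From mathcomp Require Import all_classical topology.
Set Implicit Arguments.
Unset Strict Implicit.
Unset Printing Implicit Defensive.
Import GRing.Theory.
Local Open Scope classical_set_scope.
Local Open Scope ring_scope.

(* The ideals of ring_quotient.v are proper by definition and live over
   nontrivial rings. Here the improper ideal is allowed, and so is the
   zero ring, whose maximal spectrum is empty. *)
Definition is_ideal (R : comPzRingType) (I : set R) : Prop :=
  [/\ I 0, (forall x y, I x -> I y -> I (x + y))
         & (forall r x, I x -> I (r * x))].

Definition is_maximal_ideal (R : comPzRingType) (M : set R) : Prop :=
  [/\ is_ideal M, M <> setT
    & forall I : set R, is_ideal I -> M `<=` I -> I = M \/ I = setT].

Definition jacobson_radical (R : comPzRingType) : set R :=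
  \bigcap_(M in @is_maximal_ideal R) M.
Arguments jacobson_radical : clear implicits.

Definition Ann (R : comPzRingType) (S : set R) : set R :=
  [set r | forall s, S s -> r * s = 0].

Record maxSpec (R : comPzRingType) := MaxSpec {
  max_ideal : set R;
  max_idealP : is_maximal_ideal max_ideal }.

HB.instance Definition _ (R : comPzRingType) := gen_eqMixin (maxSpec R).
HB.instance Definition _ (R : comPzRingType) := gen_choiceMixin (maxSpec R).

Definition basicD (R : comPzRingType) (a : R) : set (maxSpec R) :=
  [set M : maxSpec R | ~ max_ideal M a].

Definition zariski_open (R : comPzRingType) (U : set (maxSpec R)) : Prop :=
  exists S : set R, U = \bigcup_(a in S) basicD a.

Section ZariskiTopology.
Variable R : comPzRingType.
Implicit Types M : maxSpec R.

Lemma max_ideal1 M : ~ max_ideal M 1.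
Proof.
case: M => M /= [[_ _ MM] MT _] M1; apply: MT.
by apply/seteqP; split=> // x _; rewrite -(mulr1 x); exact: MM.
Qed.

Lemma max_ideal_prime M a b :
  max_ideal M (a * b) -> max_ideal M a \/ max_ideal M b.
Proof.
have M1 := @max_ideal1 M.
case: M M1 => M /= [[M0 MD MM] MT Mmax] M1 Mab.
have [Ma|nMa] := pselect (M a); [by left|right].
pose I : set R := [set z | exists m r, M m /\ z = m + r * a].
have Iid : is_ideal I.
  split.
  - by exists 0, 0; rewrite mul0r addr0.
  - move=> _ _ [m [r [Mm ->]]] [n [s [Mn ->]]].
    by exists (m + n), (r + s); rewrite mulrDl addrACA; split=> //; exact: MD.
  - move=> t _ [m [r [Mm ->]]].
    by exists (t * m), (t * r); rewrite mulrDr mulrA; split=> //; exact: MM.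
have MI : M `<=` I by move=> m Mm; exists m, 0; rewrite mul0r addr0.
case: (Mmax I Iid MI) => IE.
  by exfalso; apply: nMa; rewrite -IE; exists 0, 1; rewrite mul1r add0r.
have [m [r [Mm E1]]] : I 1 by rewrite IE.
rewrite -(mul1r b) E1 mulrDl mulrC -mulrA.
by apply: MD; exact: MM.
Qed.

Lemma basicDM (a b : R) : basicD a `&` basicD b = basicD (a * b).
Proof.
apply/seteqP; split=> M /=.
  by move=> [Ma Mb] /max_ideal_prime[].
have [[_ _ MM] _ _] := max_idealP M.
by move=> Mab; split=> ?; apply: Mab; [rewrite mulrC|]; exact: MM.
Qed.

Let zariski_openT : zariski_open [set: maxSpec R].
Proof.
exists [set 1]; rewrite bigcup_set1.
by apply/seteqP; split=> // M _; exact: max_ideal1.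
Qed.

Let zariski_openI : setI_closed (@zariski_open R).
Proof.
move=> _ _ [S ->] [T ->].
exists [set c | exists a b, [/\ S a, T b & c = a * b]].
apply/seteqP; split=> M.
  move=> [[a Sa Da] [b Tb Db]]; exists (a * b); first by exists a, b.
  by rewrite -basicDM.
move=> [_ [a [b [Sa Tb ->]]]]; rewrite -basicDM => -[Da Db].
by split; [exists a | exists b].
Qed.

Let zariski_open_bigU (I : Type) (f : I -> set (maxSpec R)) :
  (forall i, zariski_open (f i)) -> zariski_open (\bigcup_i f i).
Proof.
move=> /choice[S fS]; exists (\bigcup_i S i).
apply/seteqP; split=> M.
  by move=> [i _]; rewrite fS => -[a Sa Da]; exists a => //; exists i.
by move=> [a [i _ Sa] Da]; exists i => //; rewrite fS; exists a.
Qed.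

HB.instance Definition _ := isOpenTopological.Build (maxSpec R)
  zariski_openT zariski_openI zariski_open_bigU.

Lemma open_zariskiE : (open : set_system (maxSpec R)) = @zariski_open R.
Proof. by []. Qed.

End ZariskiTopology.

Definition EZ_space (Y : topologicalType) : Prop :=
  forall A : set Y, open A ->
    exists F : set (set Y),
      F `<=` clopen /\ closure A = closure (\bigcup_(B in F) B).

(* Main.v *)
(** For [J(R) = 0], the annihilator of a set [S] and the closure of the open set
    [U(S) = \bigcup_(s in S) D(s)] determine each other: [r] annihilates [S] iff
    [D(r)] misses [U(S)]. Every open set is [U(I)] for an ideal [I], and the
    clopen sets are exactly the [D(e)] with [e] idempotent, so the two
    conditions translate into one another. *)
Require Import Defs.
From mathcomp Require Import all_boot all_order all_algebra.
From mathcomp Require Import all_classical topology.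
Import GRing.Theory.
Local Open Scope classical_set_scope.
Local Open Scope ring_scope.

(** Krull's theorem by Zorn's lemma: a chain of ideals avoiding [1] has a union that is an ideal
    avoiding [1]. *)
Lemma proper_ideal_sub_maximal (R : comPzRingType) (I : set R) :
  is_ideal I -> ~ I 1 -> exists M : maxSpec R, I `<=` max_ideal M.
Proof.
move=> [I0 ID IM] I1.
(* Adjoining [I] makes the union of the empty chain admissible as well. *)
pose P : set (set R) := [set X | is_ideal (X `|` I) /\ ~ (X `|` I) 1].
have [|A [[Aid A1] Amax]] := @Zorn_bigcup R P.
  move=> F FP Ftot; split; last first.
    by move=> [[X FX X1]|//]; apply: (FP _ FX).2; left.
  have FD X x y : F X -> (X `|` I) x -> (X `|` I) y ->
      ((\bigcup_(X in F) X) `|` I) (x + y).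
    move=> FX Xx Xy; have [[_ XD _] _] := FP _ FX.
    by case: (XD _ _ Xx Xy) => ?; [left; exists X|right].
  split; first by right.
  - move=> x y [[X FX Xx]|Ix] [[Y FY Yy]|Iy].
    + case: (Ftot _ _ FX FY) => XY.
        by apply: (FD Y) => //; left => //; apply: XY.
      by apply: (FD X) => //; left => //; apply: XY.
    + by apply: (FD X) => //; [left|right].
    + by apply: (FD Y) => //; [right|left].
    + by right; apply: ID.
  - move=> r x [[X FX Xx]|Ix]; last by right; apply: IM.
    have [[_ _ XM] _] := FP _ FX.
    by case: (XM r x (or_introl Xx)) => ?; [left; exists X|right].
suff Mmax : is_maximal_ideal (A `|` I) by exists (MaxSpec Mmax) => x; right.
split=> //; first by move=> AT; apply: A1; rewrite AT.
move=> J Jid AJ; have [J1|J1] := pselect (J 1); [right|left].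
  by apply/seteqP; split=> // x _; rewrite -(mulr1 x); have [_ _] := Jid; apply.
have JI : J `|` I = J.
  by apply/seteqP; split=> x; [case=> // Ix; apply: AJ; right|left].
(* An [x] in [J] outside [A] would make [J] a member of [P] strictly containing [A]. *)
apply/seteqP; split=> // x Jx; left; apply: contrapT => nAx.
apply: (Amax J); last by split; rewrite JI.
by split=> [y Ay|/(_ x Jx)//]; apply: AJ; left.
Qed.

Section MaxSpec.
Variable R : comPzRingType.
Implicit Types (M : maxSpec R) (S T : set R) (B : set (maxSpec R)).

Lemma open_basicD (a : R) : open (basicD a).
Proof. by rewrite open_zariskiE; exists [set a]; rewrite bigcup_set1. Qed.

Lemma openP_basicD B :
  open B <-> forall M, B M -> exists a, basicD a M /\ basicD a `<=` B.
Proof.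
split=> [|BD].
  rewrite open_zariskiE => -[S ->] M [a Sa Da]; exists a.
  by split=> // N Na; exists a.
rewrite open_zariskiE; exists [set a | basicD a `<=` B].
apply/seteqP; split=> M; last by move=> [a aB]; exact: aB.
by case/BD => a [Da aB]; exists a.
Qed.

(** The elements [a] with [D(a)] inside [B] form an ideal, since [D(x + y)] lies in the union of
    [D(x)] and [D(y)], and [D(r * x)] in [D(x)]. *)
Lemma open_ideal B : open B ->
  exists2 I : set R, is_ideal I & B = \bigcup_(a in I) basicD a.
Proof.
move=> Bo; exists [set a | basicD a `<=` B].
  split=> [M /=|x y Bx By M /= Mxy|r x Bx M /= Mrx].
  - by have [[M0 _ _] _ _] := max_idealP M.
  - have [[_ MD _] _ _] := max_idealP M.
    have [Mx|nMx] := pselect (max_ideal M x); last exact: Bx.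
    by apply: By => My; apply: Mxy; apply: MD.
  - have [[_ _ MM] _ _] := max_idealP M.
    by apply: Bx => Mx; apply: Mrx; apply: MM.
apply/seteqP; split=> M; last by move=> [a aB]; exact: aB.
by case/(openP_basicD _).1 => // a [Da DB]; exists a.
Qed.

(** As [e * (1 - e) = 0], each maximal ideal contains [e] or [1 - e], and not both since they sum to
    [1]. *)
Lemma basicD_idemC (e : R) : e * e = e -> ~` basicD e = basicD (1 - e).
Proof.
move=> ee; apply/seteqP; split=> M /=; have [[M0 MD MM] _ _] := max_idealP M.
  by move=> /contrapT Me M1e; apply: (@max_ideal1 _ M); rewrite -(subrK e 1);
     apply: MD.
move=> M1e Me; have : max_ideal M (e * (1 - e)) by rewrite mulrBr mulr1 ee subrr.
by case/max_ideal_prime.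
Qed.

Lemma clopen_basicD_idem (e : R) : e * e = e -> clopen (basicD e).
Proof.
move=> ee; split; first exact: open_basicD.
by rewrite -openC basicD_idemC//; exact: open_basicD.
Qed.

Hypothesis J0 : jacobson_radical R = [set 0].

(** This is where [J(R) = 0] enters: [D(r)] is empty exactly when [r] lies in every maximal
    ideal. *)
Lemma basicD_eq0 (r : R) : basicD r = set0 <-> r = 0.
Proof.
split=> [D0|->].
  suff : jacobson_radical R r by rewrite J0.
  move=> M Mmax; apply: contrapT => nMr.
  by have : basicD r (MaxSpec Mmax) by []; rewrite D0.
apply/seteqP; split=> // M /=; apply.
by have [[]] := max_idealP M.
Qed.

Lemma Ann_disjoint S (r : R) :
  Ann S r <-> basicD r `&` \bigcup_(s in S) basicD s = set0.
Proof.
split=> [Sr|rS s Ss].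
  apply/seteqP; split=> // M [Mr [s Ss Ms]].
  have : (basicD r `&` basicD s) M by [].
  by rewrite basicDM (basicD_eq0 _).2//; apply: Sr.
apply/basicD_eq0; rewrite -basicDM; apply/seteqP; split=> // M [Mr Ms].
by rewrite -rS; split=> //; exists s.
Qed.

(** A point [M] is outside the closure iff some [D(r)] containing [M] misses the union, that is, iff
    some [r] outside [M] annihilates [S]. *)
Lemma closure_Ann S :
  closure (\bigcup_(s in S) basicD s) = [set M | Ann S `<=` max_ideal M].
Proof.
apply/seteqP; split=> M /=.
  move=> clM r /Ann_disjoint rS; apply: contrapT => nMr.
  have /clM[N] : nbhs M (basicD r).
    by apply: open_nbhs_nbhs; split=> //; exact: open_basicD.
  by rewrite setIC rS.
move=> SM B; rewrite nbhsE => -[C [Co CM] CB].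
have [a [Da DC]] := (openP_basicD C).1 Co M CM.
have : (basicD a `&` \bigcup_(s in S) basicD s) !=set0.
  by apply/set0P/eqP => /Ann_disjoint/SM.
by case=> N [Na NS]; exists N; split=> //; apply/CB/DC.
Qed.

Lemma eq_closure_Ann S T :
  closure (\bigcup_(s in S) basicD s) = closure (\bigcup_(t in T) basicD t) <->
  Ann S = Ann T.
Proof.
split=> [|ST]; last by rewrite !closure_Ann ST.
(* By symmetry one inclusion suffices. A point of the union over [T'] lies in the common closure, so
   it contains [Ann S'] and cannot lie in [D(r)] for [r] in [Ann S']. *)
suff AnnS S' T' : closure (\bigcup_(s in S') basicD s) =
    closure (\bigcup_(t in T') basicD t) -> Ann S' `<=` Ann T'.
  by move=> ST; apply/seteqP; split; exact: AnnS.
rewrite !closure_Ann => ST r Sr; apply/Ann_disjoint.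
apply/seteqP; split=> // M [Mr TM]; apply: Mr.
have /subset_closure : (\bigcup_(t in T') basicD t) M by [].
by rewrite closure_Ann -ST; apply.
Qed.

Lemma closed_sub_basicD B (M : maxSpec R) : closed B -> ~ B M ->
  exists2 a, ~ max_ideal M a & forall N, B N -> max_ideal N a.
Proof.
rewrite -openC => /openP_basicD Bo nBM; have [a [Da DB]] := Bo M nBM.
by exists a => // N BN; apply: contrapT => /DB.
Qed.

(* [B] and its complement are the zero sets of two comaximal ideals; writing
   [1 = a + b] accordingly, [a * b] lies in [J(R)], so [b] is idempotent. *)
Lemma clopen_idem B : clopen B -> exists2 e, e * e = e & B = basicD e.
Proof.
move=> [Bo Bc].
pose V C : set R := [set r | forall M, C M -> max_ideal M r].
pose I : set R := [set x | exists a b, [/\ V B a, V (~` B) b & x = a + b]].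
have Vid C : is_ideal (V C).
  split=> [M _|x y Vx Vy M CM|r x Vx M CM];
    have [[M0 MD MM] _ _] := max_idealP M => //.
  - by apply: MD; [exact: Vx|exact: Vy].
  - by apply: MM; exact: Vx.
have [[A0 AD AM] [C0 CD CM]] := (Vid B, Vid (~` B)).
have Iid : is_ideal I.
  split.
  - by exists 0, 0; rewrite addr0.
  - move=> _ _ [a [b [Va Vb ->]]] [c [d [Vc Vd ->]]].
    by exists (a + c), (b + d); split; [exact: AD|exact: CD|rewrite addrACA].
  - move=> r _ [a [b [Va Vb ->]]].
    by exists (r * a), (r * b); split; [exact: AM|exact: CM|rewrite mulrDr].
have [a [b [Va Vb E1]]] : I 1.
  apply: contrapT => /(proper_ideal_sub_maximal _ _ Iid)[M IM].
  have [BM|nBM] := pselect (B M).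
    have [||b nMb Vb] := @closed_sub_basicD (~` B) M.
    - by rewrite -openC setCK.
    - by move/(_ BM).
    - by apply: nMb; apply: IM; exists 0, b; rewrite add0r.
  have [a nMa Va] := closed_sub_basicD _ _ Bc nBM.
  by apply: nMa; apply: IM; exists a, 0; rewrite addr0.
have ab0 : a * b = 0.
  apply/basicD_eq0; rewrite -basicDM; apply/seteqP; split=> // M [nMa nMb].
  by have [/Va|/Vb] := pselect (B M).
exists b; first by rewrite -{3}(mul1r b) E1 mulrDl ab0 add0r.
(* Points outside [B] contain [b]; points of [B] contain [a], hence not [b], as [a + b = 1]. *)
apply/seteqP; split=> M; last by move=> nMb; apply: contrapT => /Vb.
move=> BM Mb; apply: (@max_ideal1 _ M); rewrite E1.
by have [[_ MD _] _ _] := max_idealP M; apply: MD => //; exact: Va.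
Qed.

End MaxSpec.

Theorem theorem4p4 (R : comPzRingType)
    (J0 : jacobson_radical R = [set 0]) :
  EZ_space (maxSpec R) <->
  (forall I : set R, is_ideal I ->
    exists E : set R,
      (forall e, E e -> e * e = e) /\ Ann I = Ann E).
Proof.
split=> [EZ I _|AnnE A /open_ideal[I Iid ->]].
  have [|F [Fclopen clF]] := EZ (\bigcup_(a in I) basicD a).
    by apply: bigcup_open => a _; exact: open_basicD.
  (* Every member of [F] is some [D(e)], so these idempotents give the same union as [F]. *)
  exists [set e | e * e = e /\ F (basicD e)]; split=> [e []//|].
  apply/(eq_closure_Ann _ J0); rewrite clF; congr closure.
  apply/seteqP; split=> M; last by case=> e [_ Fe] Me; exists (basicD e).
  move=> [B FB BM]; have [e ee BE] := clopen_idem _ J0 _ (Fclopen _ FB).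
  by exists e; rewrite /= -BE.
have [E [Eidem IE]] := AnnE I Iid.
exists (@basicD R @` E); split; first last.
  by rewrite bigcup_image; apply/(eq_closure_Ann _ J0).
by move=> _ [e Ee <-]; apply: clopen_basicD_idem; exact: Eidem.
Qed.
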